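(* Let $I$ be a finite set and let $\mathfrak p\subseteq \mathbb R I$ be a (bounded) generalized permutahedron. The antipode $\mathsf s_I$ of the Hopf monoid $\mathbf{GP}$ of generalized permutahedra is given by the following cancellation-free and grouping-free formula: $$\mathsf s_I(\mathfrak p)=(-1)^{|I|}\sum_{\mathfrak q}(-1)^{\dim\mathfrak q}\,\mathfrak q ,$$ where the sum runs over all nonempty faces $\mathfrak q$ of $\mathfrak p$ (including $\mathfrak p$ itself).
   Context: Fix a field $\Bbbk$ of characteristic $0$. For a finite set $I$, $\mathbb R I$ is the real vector space with basis $\{e_i\}_{i\in I}$ and $\mathbb R^I$ (functions $y:I\to\mathbb R$) is its dual, acting by $y(\sum a_ie_i)=\sum a_iy(i)$. For a polytope $\mathfrak p\subseteq\mathbb R I$ and $y\in\mathbb R^I$, $\mathfrak p_y$ is the face of $\mathfrak p$ on which $y$ is maximal. The braid arrangement in $\mathbb R^I$ consists of the hyperplanes $y(i)=y(j)$, $i\ne j$; its faces form a complete fan. A generalized permutahedron in $\mathbb R I$ is a nonempty polytope whose normal fan (cones $\{y: \mathfrak q \text{ is a face of }\mathfrak p_y\}$, for faces $\mathfrak q$) is a coarsening of the braid arrangement fan, i.e. every cone of the normal fan is a union of cones of the braid fan. $\mathrm{GP}[I]$ is the set of (bounded) generalized permutahedra in $\mathbb R I$, and $\mathbf{GP}[I]$ is the $\Bbbk$-vector space with basis $\mathrm{GP}[I]$. For an ordered decomposition $I=S\sqcup T$ the product is $\mu_{S,T}(\mathfrak p\otimes\mathfrak q)=\mathfrak p\times\mathfrak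 q\subseteq\mathbb RS\times\mathbb RT=\mathbb RI$, and the coproduct is $\Delta_{S,T}(\mathfrak p)=\mathfrak p|_S\otimes\mathfrak p/_S$, where $\mathfrak p|_S\subseteq\mathbb RS$ and $\mathfrak p/_S\subseteq\mathbb RT$ are the generalized permutahedra determined by $\mathfrak p_{\mathbf 1_S}=\mathfrak p|_S\times\mathfrak p/_S$, with $\mathbf 1_S(x)=\sum_{i\in S}x_i$. These operations make $\mathbf{GP}$ a connected Hopf monoid. For $I=S_1\sqcup\cdots\sqcup S_k$, $\mu_{S_1,\dots,S_k}$ and $\Delta_{S_1,\dots,S_k}$ denote the iterated product and coproduct (well defined by associativity; for $k=1$ they are identities). The antipode is $\mathsf s_\emptyset=\mathrm{id}$ and, for $I\neq\emptyset$, $\mathsf s_I=\sum(-1)^k\mu_{S_1,\dots,S_k}\circ\Delta_{S_1,\dots,S_k}$, summed over all $k\ge1$ and all ordered sequences $(S_1,\dots,S_k)$ of nonempty pairwise disjoint sets with union $I$. A formula expressing an element as a signed sum $\sum_\alpha c_\alpha x_\alpha$ of basis elements is cancellation-free if there are no $\alpha\neq\beta$ with $x_\alpha=x_\beta$ and $c_\alpha,c_\beta$ of opposite sign, and grouping-free if the $x_\alpha$ are pairwise distinct. *)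

(* Defs.v *)
From HB Require Import structures.
From mathcomp Require Import all_boot all_order all_algebra.
From mathcomp Require Import boolp classical_sets functions cardinality fsbigop.
From mathcomp Require Import reals.
From mathcomp Require Import freeg.
From mathcomp Require Import ring lra.

Set Implicit Arguments.
Unset Strict Implicit.
Unset Printing Implicit Defensive.

Import Order.TTheory GRing.Theory Num.Theory.

Local Open Scope classical_set_scope.
Local Open Scope ring_scope.

(* fintype's [disjoint S & U], whose notation classical_sets overrides *)
Notation disjoint_sets S U := (fintype.disjoint (mem S) (mem U)).

(* Finite sets are the finite subsets I of an arbitrary finType T.  Both R I
   and its dual R^I are realised as the coordinate subspace of R^T of vectors
   vanishing outside I.  Hence R S and R U are subspaces of R (S :|: U), and the
   identification R S x R U = R (S :|: U), for S and U disjoint, is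
   (x, y) |-> x + y. *)
Notation vec R T := {ffun T -> R^o}.

Section Polytopes.
Variables (R : realType) (T : finType).
Implicit Types (I S U : {set T}) (x y z : vec R T) (p q : set (vec R T)).

Definition dot y x : R := \sum_i y i * x i.

Definition coord_space I : set (vec R T) :=
  [set x | forall i, i \notin I -> x i = 0].

Definition indicator I : vec R T := [ffun i => (i \in I)%:R].

Definition conv (J : finType) (v : J -> vec R T) : set (vec R T) :=
  [set x | exists w : J -> R,
    [/\ forall j, 0 <= w j, \sum_j w j = 1 & x = \sum_j w j *: v j]].

Definition polytope p := exists (J : finType) (v : J -> vec R T), p = conv v.

(* the face p_y on which y is maximal *)
Definition face p y : set (vec R T) :=
  [set x | p x /\ forall x', p x' -> dot y x' <= dot y x].

Definition is_face I p q := exists2 y, coord_space I y & q = face p y.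

Definition normal_cone I p q : set (vec R T) :=
  [set y | coord_space I y /\ is_face I (face p y) q].

(* the face of the braid arrangement having z in its relative interior *)
Definition braid_cone I z : set (vec R T) :=
  [set y | coord_space I y /\
           {in I &, forall i j, z i <= z j -> y i <= y j}].

Definition braid_fan I : set (set (vec R T)) :=
  [set C | exists2 z, coord_space I z & C = braid_cone I z].

Definition is_gp I p :=
  [/\ p `<=` coord_space I, polytope p, p !=set0 &
      forall q, is_face I p q ->
        exists2 F, F `<=` braid_fan I & normal_cone I p q = \bigcup_(C in F) C].

(* the set of directions of the affine hull: the least linear subspace
   containing all the differences of points of p *)
Definition direction p : {vspace vec R T} :=
  let contains V := forall x y, p x -> p y -> x - y \in V in
  xget 0%VS [set V : {vspace vec R T} |
    contains V /\ forall W : {vspace vec R T}, contains W -> (V <= W)%VS].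

Lemma directionP p :
  (forall x y, p x -> p y -> x - y \in direction p) /\
  forall W : {vspace vec R T},
    (forall x y, p x -> p y -> x - y \in W) -> (direction p <= W)%VS.
Proof.
pose spans (V : {vspace vec R T}) := forall x y, p x -> p y -> x - y \in V.
rewrite /direction; apply: (xgetPex 0%VS (P := [set V | spans V /\ forall W, spans W -> (V <= W)%VS])).
pose P n := `[< exists2 V : {vspace vec R T}, spans V & \dim V = n >].
have exP : exists n, P n.
  by exists (\dim {: vec R T}); apply/asboolP; exists fullv => // x y _ _; rewrite memvf.
case: (ex_minnP exP) => n /asboolP[V sV dV] min.
exists V; split=> // W sW.
have sVW : spans (V :&: W)%VS.
  by move=> x y px py; rewrite memv_cap sV ?sW.
have : (\dim V <= \dim (V :&: W))%N.
  by rewrite dV; apply: min; apply/asboolP; exists (V :&: W)%VS.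
by move=> le; apply/capv_idPl/eqP; rewrite eqEdim capvSl.
Qed.

Definition polytope_dim p : nat := \dim (direction p).

Definition prod_set p q : set (vec R T) := [set x + y | x in p & y in q].

Definition restr I x : vec R T := [ffun i => if i \in I then x i else 0].

Lemma dotDl y z x : dot (y + z) x = dot y x + dot z x.
Proof.
by rewrite /dot -big_split; apply: eq_bigr => i _; rewrite ffunE mulrDl.
Qed.

Lemma dotZl (a : R) y x : dot (a *: y) x = a * dot y x.
Proof.
by rewrite /dot mulr_sumr; apply: eq_bigr => i _; rewrite ffunE mulrA.
Qed.

Lemma dotC y x : dot y x = dot x y.
Proof. by apply: eq_bigr => i _; rewrite mulrC. Qed.

Lemma dotDr y x z : dot y (x + z) = dot y x + dot y z.
Proof. by rewrite dotC dotDl !(dotC y). Qed.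

Lemma dotZr (a : R) y x : dot y (a *: x) = a * dot y x.
Proof. by rewrite dotC dotZl (dotC y). Qed.

Lemma dot0r y : dot y 0 = 0.
Proof. by rewrite /dot big1 // => i _; rewrite ffunE mulr0. Qed.

Lemma dot_sumr y (J : finType) (w : J -> R) (v : J -> vec R T) :
  dot y (\sum_j w j *: v j) = \sum_j w j * dot y (v j).
Proof.
elim/big_ind2: _ => [|a b c d <- <-|j _]; [exact: dot0r|exact: dotDr|].
exact: dotZr.
Qed.

Lemma dot_gt0 x : x != 0 -> 0 < dot x x.
Proof.
move=> x0; rewrite lt_neqAle eq_sym; apply/andP; split; last first.
  by apply: sumr_ge0 => i _; rewrite -expr2 sqr_ge0.
apply: contra x0 => /eqP/psumr_eq0P h; apply/eqP/ffunP => i; rewrite ffunE.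
apply/eqP; rewrite -sqrf_eq0 expr2; apply/eqP/h => // j _.
by rewrite -expr2 sqr_ge0.
Qed.

Lemma restrD I x y : restr I (x + y) = restr I x + restr I y.
Proof. by apply/ffunP => i; rewrite !ffunE; case: ifP => _ //; rewrite addr0. Qed.

Lemma restrZ I (a : R) x : restr I (a *: x) = a *: restr I x.
Proof. by apply/ffunP => i; rewrite !ffunE; case: ifP => _ //; rewrite scaler0. Qed.

Lemma restr_sum I (J : finType) (w : J -> R) (v : J -> vec R T) :
  restr I (\sum_j w j *: v j) = \sum_j w j *: restr I (v j).
Proof.
elim/big_ind2: _ => [|a b c d <- <-|j _]; last exact: restrZ.
  by apply/ffunP => i; rewrite !ffunE; case: ifP.
exact: restrD.
Qed.

Lemma restr_coord I x : coord_space I (restr I x).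
Proof. by move=> i /negbTE iI; rewrite ffunE iI. Qed.

Lemma restr_id I x : coord_space I x -> restr I x = x.
Proof. by move=> h; apply/ffunP => i; rewrite ffunE; case: ifPn => // /h. Qed.

Lemma restr_disj I S x : disjoint_sets I S -> coord_space S x -> restr I x = 0.
Proof.
move=> d h; apply/ffunP => i; rewrite !ffunE; case: ifPn => // iI.
by apply: h; rewrite (disjointFr d).
Qed.

Lemma dot_restr I y x : coord_space I x -> dot (restr I y) x = dot y x.
Proof.
move=> h; apply: eq_bigr => i _; rewrite ffunE; case: ifPn => // /h ->.
by rewrite !mulr0.
Qed.

Lemma dot_restrr I y x : coord_space I y -> dot y (restr I x) = dot y x.
Proof. by move=> h; rewrite dotC dot_restr // dotC. Qed.

Lemma coordD I x y : coord_space I x -> coord_space I y -> coord_space I (x + y).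
Proof. by move=> hx hy i iI; rewrite ffunE hx // hy // addr0. Qed.

Lemma coordZ I (a : R) x : coord_space I x -> coord_space I (a *: x).
Proof. by move=> hx i iI; rewrite ffunE hx // scaler0. Qed.

Lemma coordS I S x : I \subset S -> coord_space I x -> coord_space S x.
Proof. by move=> /fintype.subsetP s h i iS; apply: h; apply: contra iS; apply: s. Qed.

Lemma indicator_coord I S : I \subset S -> coord_space S (indicator I).
Proof.
move=> /fintype.subsetP s i iS; rewrite ffunE; case: (boolP (i \in I)) => // /s h.
by rewrite h in iS.
Qed.

Lemma conv_mem (J : finType) (v : J -> vec R T) j : conv v (v j).
Proof.
exists (fun i => (i == j)%:R); split.
- by move=> i; rewrite ler0n.
- by rewrite (bigD1 j) //= eqxx big1 ?addr0 // => i /negbTE ->.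
- rewrite (bigD1 j) //= eqxx scale1r big1 ?addr0 // => i /negbTE ->.
  by rewrite scale0r.
Qed.

Lemma conv_dot_le (J : finType) (v : J -> vec R T) y c x :
  (forall j, dot y (v j) <= c) -> conv v x -> dot y x <= c.
Proof.
move=> h [w [w0 w1 ->]]; rewrite dot_sumr -[leRHS]mul1r -w1 mulr_suml.
by apply: ler_sum => j _; rewrite ler_wpM2l.
Qed.

Lemma conv_dot_ge (J : finType) (v : J -> vec R T) y c x :
  (forall j, c <= dot y (v j)) -> conv v x -> c <= dot y x.
Proof.
move=> h [w [w0 w1 ->]]; rewrite dot_sumr -[leLHS]mul1r -w1 mulr_suml.
by apply: ler_sum => j _; rewrite ler_wpM2l.
Qed.

Lemma face_sub p y : face p y `<=` p.
Proof. by move=> x []. Qed.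

Lemma conv_max (J : finType) (v : J -> vec R T) y :
  conv v !=set0 -> exists j, face (conv v) y (v j).
Proof.
move=> [x [w [w0 w1 _]]].
have [j0 _|J0] := pickP J; last first.
  by move: w1; rewrite big1 => [/eqP|j _]; [rewrite eq_sym oner_eq0|have := J0 j].
pose j := [arg max_(j > j0) dot y (v j)]%O; exists j; split; first exact: conv_mem.
move=> x'; apply: conv_dot_le => i; rewrite /j.
by case: arg_maxP => // j1 _ h; apply: h.
Qed.

Lemma polytope_face_neq0 p y : polytope p -> p !=set0 -> face p y !=set0.
Proof. by move=> [J [v ->]] /(conv_max y)[j hj]; exists (v j). Qed.

Lemma conv_convex (J K : finType) (v : J -> vec R T) (u : K -> vec R T) :
  (forall k, conv v (u k)) -> conv u `<=` conv v.
Proof.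
move=> /choice[W hW] x [w [w0 w1 ->]].
exists (fun j => \sum_k w k * W k j); split.
- by move=> j; apply: sumr_ge0 => k _; rewrite mulr_ge0 //; case: (hW k).
- rewrite exchange_big /= -w1; apply: eq_bigr => k _.
  by rewrite -mulr_sumr; case: (hW k) => _ -> _; rewrite mulr1.
- under [RHS]eq_bigr do rewrite scaler_suml.
  rewrite exchange_big /=; apply: eq_bigr => k _.
  case: (hW k) => _ _ {1}->; rewrite scaler_sumr.
  by apply: eq_bigr => j _; rewrite scalerA.
Qed.

Lemma polytope_face p y : polytope p -> p !=set0 -> polytope (face p y).
Proof.
move=> [J [v ->]] /(conv_max y)[j0 f0].
have [_ m0] := f0.
pose P j := `[< face (conv v) y (v j) >].
exists J, (fun j => if P j then v j else v j0).
apply/seteqP; split => x; last first.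
  set v' := (fun j => _) => cx.
  have fv' j : face (conv v) y (v' j).
    by rewrite /v'; case: ifPn => // /asboolP.
  split; first by apply: conv_convex cx => j; apply: face_sub (fv' j).
  move=> x' px'; apply: (le_trans (m0 _ px')).
  by apply: conv_dot_ge cx => j; have [_] := fv' j; apply; case: f0.
move=> [[w [w0 w1 ->]] mx]; exists w; split=> //; apply: eq_bigr => j _.
case: ifPn => // /asboolP nP.
suff -> : w j = 0 by rewrite !scale0r.
have h i : dot y (v i) <= dot y (v j0) by apply/m0/conv_mem.
have : \sum_i w i * (dot y (v j0) - dot y (v i)) = 0.
  apply/eqP; rewrite eq_le; apply/andP; split; last first.
    by apply: sumr_ge0 => i _; rewrite mulr_ge0 // subr_ge0.
  have := mx _ (face_sub f0); rewrite dot_sumr -subr_le0; apply: le_trans.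
  under eq_bigr do rewrite mulrBr.
  by rewrite sumrB -mulr_suml w1 mul1r.
move/psumr_eq0P => /(_ _ j isT) H.
have /eqP : w j * (dot y (v j0) - dot y (v j)) = 0.
  by apply: H => i _; rewrite mulr_ge0 // subr_ge0.
rewrite mulf_eq0 => /orP[/eqP //|]; rewrite subr_eq0 => /eqP e.
by case: nP; split=> [|x']; [exact: conv_mem|rewrite -e; exact: m0].
Qed.

Lemma polytope_restr p I : polytope p -> polytope (restr I @` p).
Proof.
move=> [J [v ->]]; exists J, (restr I \o v); apply/seteqP; split => x.
  by move=> [_ [w [w0 w1 ->]] <-]; exists w; split=> //; rewrite restr_sum.
move=> [w [w0 w1 ->]]; exists (\sum_j w j *: v j); last exact: restr_sum.
by exists w.
Qed.

Lemma polytope_prod p q : polytope p -> polytope q -> polytope (prod_set p q).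
Proof.
move=> [J [v ->]] [K [u ->]].
exists (J * K)%type, (fun jk => v jk.1 + u jk.2); apply/seteqP; split => x.
  move=> [_ [w [w0 w1 ->]] [_ [t [t0 t1 ->]] <-]].
  exists (fun jk => w jk.1 * t jk.2); split.
  - by move=> jk; rewrite mulr_ge0.
  - rewrite -(pair_bigA _ (fun j k => w j * t k)) /= -w1.
    by apply: eq_bigr => j _; rewrite -mulr_sumr t1 mulr1.
  - rewrite -(pair_bigA _ (fun j k => (w j * t k) *: (v j + u k))) /=.
    under [RHS]eq_bigr => j _ do
      [under eq_bigr do rewrite scalerDr; rewrite big_split /= -scaler_suml
        -mulr_sumr t1 mulr1].
    rewrite big_split /=; congr (_ + _); rewrite exchange_big /=.
    apply: eq_bigr => k _; rewrite -scaler_suml -mulr_suml w1 mul1r //.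
move=> [w [w0 w1 ->]].
exists (\sum_j (\sum_k w (j, k)) *: v j).
  exists (fun j => \sum_k w (j, k)); split=> //.
    by move=> j; apply: sumr_ge0.
  by rewrite pair_bigA /= -w1; apply: eq_bigr => -[].
exists (\sum_k (\sum_j w (j, k)) *: u k).
  exists (fun k => \sum_j w (j, k)); split=> //.
    by move=> k; apply: sumr_ge0.
  by rewrite exchange_big pair_bigA /= -w1; apply: eq_bigr => -[].
under eq_bigr do rewrite scaler_suml.
under [X in _ + X]eq_bigr do rewrite scaler_suml.
rewrite [X in _ + X]exchange_big /= !pair_bigA /= -big_split /=.
by apply: eq_bigr => -[j k] _; rewrite scalerDr.
Qed.

Lemma face_in_face p y z :
  face p z `<=` face p y -> face p z !=set0 -> face (face p y) z = face p z.
Proof.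
move=> s [f ff]; apply/seteqP; split => x.
  move=> [[px my] mz]; split=> // x' px'.
  by case: ff (s _ ff) => pf mf sf; apply: le_trans (mz _ sf); apply: mf.
by move=> fx; split; [apply: s|move=> x' [px' _]; case: fx => _; apply].
Qed.

Lemma gpP I p : is_gp I p <->
  [/\ p `<=` coord_space I, polytope p, p !=set0 &
      forall z y, coord_space I z -> braid_cone I z y -> face p z `<=` face p y].
Proof.
have bz z : coord_space I z -> braid_cone I z z by move=> cz; split.
split=> -[sp pp p0 h]; split=> //.
  move=> z y cz zy.
  have [|F FB NF] := h (face p z); first by exists z.
  have : normal_cone I p (face p z) z.
    split=> //; exists z => //; rewrite face_in_face //.
    exact: polytope_face_neq0.
  rewrite NF => -[C FC Cz].
  have : (\bigcup_(C in F) C) y.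
    exists C => //; have [w cw Cw] := FB _ FC; subst C.
    case: zy => cy zy; split=> // i j iI jI ij; apply: zy => //.
    by case: Cz => _; apply.
  by rewrite -NF => -[_ [u _ ->]] x [].
move=> q [z cz ->].
exists [set C | exists2 y, normal_cone I p (face p z) y & C = braid_cone I y].
  by move=> C [y [cy _] ->]; exists y.
apply/seteqP; split=> y.
  by move=> ny; exists (braid_cone I y); [exists y|apply: bz; case: ny].
move=> [_ [w [cw [u cu e]] ->] wy]; split; first by case: wy.
have s : face p z `<=` face p y.
  by apply: subset_trans (h _ _ cw wy); rewrite e => x [].
by exists z => //; rewrite face_in_face //; exact: polytope_face_neq0.
Qed.

Lemma small_all (J : finType) (P : J -> R -> Prop) :
  (forall j, exists2 e, 0 < e & forall t, 0 < t <= e -> P j t) ->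
  exists2 e, 0 < e & forall t, 0 < t <= e -> forall j, P j t.
Proof.
move=> h.
have [e e0 he] : exists2 e, 0 < e &
    forall t, 0 < t <= e -> forall j, j \in enum J -> P j t.
  elim: (enum J) => [|j s [e e0 he]]; first by exists 1.
  have [e1 e10 he1] := h j; exists (Num.min e e1).
    by rewrite lt_min e0.
  move=> t; rewrite le_min => /and3P[t0 te te1] i; rewrite inE => /orP[/eqP ->|].
    by apply: he1; rewrite t0.
  by apply: he; rewrite t0.
by exists e => // t te j; apply: he => //; rewrite mem_enum.
Qed.

Lemma small_lt (a b c : R) : a < b ->
  exists2 e, 0 < e & forall t, 0 < t <= e -> a + t * c < b.
Proof.
move=> ab; have c1 : 0 < `|c| + 1 by rewrite ltr_wpDl.
have d0 : 0 < (b - a) / (`|c| + 1) by rewrite divr_gt0 // subr_gt0.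
exists ((b - a) / (`|c| + 1) / 2%:R); first by rewrite divr_gt0.
move=> t /andP[t0 te]; rewrite -ltrBrDl.
have tc : t * c <= t * (`|c| + 1).
  by rewrite ler_wpM2l ?(ltW t0) // (le_trans (ler_norm c)) // lerDl.
apply: (le_lt_trans tc); rewrite -ltr_pdivlMr //; apply: (le_lt_trans te).
by rewrite ltr_pdivrMr // mulr_natr mulr2n ltrDl.
Qed.

Lemma face_perturb p a z : polytope p -> p !=set0 ->
  exists2 e, 0 < e &
    forall t, 0 < t <= e -> face p (a + t *: z) = face (face p a) z.
Proof.
move=> pp p0; have pf := polytope_face a pp p0.
have [f0 [ff mf]] := polytope_face_neq0 z pf (polytope_face_neq0 a pp p0).
have [pf0 ma] := ff.
have [e e0 he] : exists2 e, 0 < e & forall t, 0 < t <= e -> forall x, p x ->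
    dot a x + t * dot z x <= dot a f0 + t * dot z f0.
  case: pp ff ma mf => J [v ->] ff ma mf.
  have [|e e0 he] := @small_all J (fun j t =>
      dot a (v j) + t * dot z (v j) <= dot a f0 + t * dot z f0).
    move=> j; have : dot a (v j) <= dot a f0 by apply/ma/conv_mem.
    rewrite le_eqVlt => /orP[/eqP E|L].
      exists 1 => // t /andP[t0 _]; rewrite E lerD2l ler_wpM2l ?(ltW t0) //.
      by apply: mf; split=> [|x' /ma]; [exact: conv_mem|rewrite E].
    have [e e0 he] := small_lt (dot z (v j) - dot z f0) L.
    by exists e => // t /he; rewrite mulrBr addrA ltrBlDr => /ltW.
  exists e => // t /he h x cx; rewrite -!dotZl -!dotDl.
  by apply: conv_dot_le cx => j; rewrite !dotDl !dotZl.
exists (e / 2%:R); first by rewrite divr_gt0.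
move=> t /andP[t0 te].
have te2 : 0 < t * 2%:R <= e by rewrite mulr_gt0 //= -ler_pdivlMr.
have te1 : 0 < t <= e.
  rewrite t0 (le_trans te) // ler_pdivrMr // mulr_natr mulr2n lerDl.
  exact: ltW.
apply/seteqP; split=> x.
  move=> [px mx]; have := mx _ pf0; rewrite !dotDl !dotZl => E.
  have E2 := he _ te2 _ px; have E1 := ma _ px.
  have zx : dot z f0 <= dot z x.
    have : t * dot z f0 <= t * dot z x by nra.
    by rewrite ler_pM2l.
  have zx' : dot z x <= dot z f0.
    have : t * dot z x <= t * dot z f0 by lra.
    by rewrite ler_pM2l.
  have ez : dot z x = dot z f0 by apply/eqP; rewrite eq_le zx'.
  have ea : dot a x = dot a f0.
    by apply/eqP; rewrite eq_le E1 /=; move: E; rewrite ez lerD2r.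
  split; first by split=> // x' /ma; rewrite ea.
  by move=> x' /mf; rewrite ez.
move=> [[px ax] zx]; split=> // x' /(he _ te1) h; rewrite !dotDl !dotZl.
apply: (le_trans h); apply: lerD; first exact: ax.
by rewrite ler_wpM2l ?(ltW t0) //; apply: zx.
Qed.

Lemma braid_perturb I a z y :
  {in I &, forall i j, a i = a j -> z i <= z j -> y i <= y j} ->
  exists2 e, 0 < e & forall t, 0 < t <= e ->
    {in I &, forall i j, a i + t * z i <= a j + t * z j ->
                         a i + t * y i <= a j + t * y j}.
Proof.
move=> h.
have [|e e0 he] := @small_all (T * T)%type (fun ij t =>
    ij.1 \in I -> ij.2 \in I -> a ij.1 + t * z ij.1 <= a ij.2 + t * z ij.2 ->
      a ij.1 + t * y ij.1 <= a ij.2 + t * y ij.2); last first.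
  by exists e => // t /he H i j iI jI; apply: (H (i, j)).
move=> [i j]; rewrite [(i, j).1]/= [(i, j).2]/=.
have [ij|ji|E] := ltgtP (a i) (a j).
- have [e e0 he] := small_lt (y i - y j) ij; exists e => // t /he.
  rewrite mulrBr addrA ltrBlDr => /ltW H _ _ _; exact: H.
- have [e e0 he] := small_lt (z j - z i) ji; exists e => // t /he.
  rewrite mulrBr addrA ltrBlDr => H _ _ H'.
  by have := lt_le_trans H H'; rewrite ltxx.
- exists 1 => // t /andP[t0 _] iI jI; rewrite E !lerD2l.
  rewrite (ler_pM2l t0) => /(h _ _ iI jI E) H.
  by rewrite -subr_ge0 -mulrBr mulr_ge0 ?(ltW t0) // subr_ge0.
Qed.

Lemma gp_face_sub I p a z y : is_gp I p ->
  coord_space I a -> coord_space I z -> coord_space I y ->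
  {in I &, forall i j, a i = a j -> z i <= z j -> y i <= y j} ->
  face (face p a) z `<=` face (face p a) y.
Proof.
move=> /gpP[_ pp p0 h] ca cz cy /braid_perturb[e e0 he].
have [e1 e10 h1] := face_perturb a z pp p0.
have [e2 e20 h2] := face_perturb a y pp p0.
pose t := Num.min e (Num.min e1 e2).
have t0 : 0 < t by rewrite !lt_min e0 e10.
have te : t <= e by rewrite ge_min lexx.
have te1 : t <= e1 by rewrite !ge_min lexx orbT.
have te2 : t <= e2 by rewrite !ge_min lexx !orbT.
rewrite -(h1 t) ?t0 // -(h2 t) ?t0 //; apply: h.
  exact/coordD/coordZ.
split; first exact/coordD/coordZ.
by move=> i j iI jI; rewrite !ffunE; apply: he; rewrite ?t0.
Qed.

Lemma is_gp_face I p a : is_gp I p -> coord_space I a -> is_gp I (face p a).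
Proof.
move=> gp ca; have /gpP[sp pp p0 h] := gp; apply/gpP; split.
- exact: subset_trans (@face_sub p a) sp.
- exact: polytope_face.
- exact: polytope_face_neq0.
- move=> z y cz [cy zy]; apply: (gp_face_sub gp) => // i j iI jI _.
  exact: zy.
Qed.

Lemma is_gp_prod S U p q : is_gp S p -> is_gp U q ->
  is_gp (S :|: U) (prod_set p q).
Proof.
move=> /gpP[sp pp [x0 p0] hp] /gpP[sq pq [x1 q0] hq]; apply/gpP; split.
- move=> _ [x px [y qy <-]]; apply: coordD.
    exact/(coordS (finset.subsetUl S U))/sp.
  exact/(coordS (finset.subsetUr S U))/sq.
- exact: polytope_prod.
- by exists (x0 + x1), x0 => //; exists x1.
- move=> z y cz [cy zy] _ [[x px [x' qx' <-]] m].
  have restr_cone (V : {set T}) : V \subset S :|: U ->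
      braid_cone V (restr V z) (restr V y).
    move=> /fintype.subsetP VS; split; first exact: restr_coord.
    move=> i j iV jV; rewrite !ffunE iV jV; apply: zy; exact: VS.
  have fx : face p y x.
    suff : face p (restr S y) x.
      move=> [_ h]; split=> // w pw; have := h _ pw.
      by rewrite !dot_restr //; exact: sp.
    apply: (hp (restr S z)); first exact: restr_coord.
      exact/restr_cone/finset.subsetUl.
    split=> // w pw; rewrite !dot_restr; [|exact: sp..].
    have := m (w + x'); rewrite !dotDr lerD2r; apply.
    by exists w => //; exists x'.
  have fx' : face q y x'.
    suff : face q (restr U y) x'.
      move=> [_ h]; split=> // w pw; have := h _ pw.
      by rewrite !dot_restr //; exact: sq.
    apply: (hq (restr U z)); first exact: restr_coord.
      exact/restr_cone/finset.subsetUr.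
    split=> // w pw; rewrite !dot_restr; [|exact: sq..].
    have := m (x + w); rewrite !dotDr lerD2l; apply.
    by exists x => //; exists w.
  split; first by exists x => //; exists x'.
  move=> _ [w pw [w' qw' <-]]; rewrite !dotDr; apply: lerD.
    by case: fx => _; apply.
  by case: fx' => _; apply.
Qed.

Lemma is_gp_origin I : is_gp I [set 0].
Proof.
apply/gpP; split.
- by move=> _ -> i _; rewrite ffunE.
- exists unit, (fun=> 0); apply/seteqP; split => x.
    move=> ->; exists (fun=> 1); split=> //.
      by rewrite big_const card_unit /= addr0.
    by rewrite big1 // => ? _; rewrite scaler0.
  by move=> [w [_ _ ->]]; rewrite big1 // => ? _; rewrite scaler0.
- by exists 0.
- by move=> z y _ _ x [-> _]; split=> // _ ->.
Qed.

End Polytopes.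

Section Separation.
Variable R : realType.

(* membership in the cone generated by a sequence of vectors *)
Fixpoint in_cone (T : finType) (s : seq (vec R T)) (b : vec R T) : Prop :=
  if s is w :: s' then exists2 l : R, 0 <= l & in_cone s' (b - l *: w)
  else b = 0.

Lemma in_cone_shift (T : finType) (s : seq (vec R T)) w (t : vec R T -> R) b :
  (forall u, u \in s -> t u <= 0) -> in_cone [seq u - t u *: w | u <- s] b ->
  exists2 l, 0 <= l & in_cone s (b - l *: w).
Proof.
elim: s b => [|u s IH] b ht /=.
  by move=> ->; exists 0 => //; rewrite scale0r subr0.
move=> [l l0] /IH[|r r0 H]; first by move=> v vs; apply: ht; rewrite inE vs orbT.
have tu : t u <= 0 by apply: ht; rewrite inE eqxx.
exists (r - l * t u); first by rewrite subr_ge0 (le_trans _ r0) // mulr_ge0_le0.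
exists l => //; congr in_cone: H.
apply/ffunP => i; rewrite !ffunE /GRing.scale /=; ring.
Qed.

Lemma farkas (T : finType) (s : seq (vec R T)) (b : vec R T) :
  in_cone s b \/
  exists2 y, (forall w, w \in s -> dot y w <= 0) & 0 < dot y b.
Proof.
elim: {s}(size s) {-2}s (erefl (size s)) b => [|n IH] [|w s] //= => [_|[sz]] b.
  have [->|b0] := eqVneq b 0; [by left|right; exists b => //].
  exact: dot_gt0.
have [H|[y ys yb]] := IH s sz b.
  by left; exists 0 => //; rewrite scale0r subr0.
have [yw|yw] := leP (dot y w) 0.
  by right; exists y => // u; rewrite inE => /orP[/eqP ->|/ys].
pose t u := dot y u / dot y w.
have [|H|[y' ys' yb']] := IH [seq u - t u *: w | u <- s] _ (b - t b *: w).
- by rewrite size_map.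
- left; have [|l l0 H'] := in_cone_shift _ H.
    by move=> u /ys us; rewrite /t mulr_le0_ge0 // invr_ge0 ltW.
  exists (t b + l); first by apply: addr_ge0 => //; apply: divr_ge0; exact: ltW.
  by rewrite scalerDl opprD addrA.
- right; have E u : dot (y' - (dot y' w / dot y w) *: y) u =
      dot y' (u - t u *: w).
    rewrite -!scaleNr dotDl dotZl dotDr dotZr /t.
    by field; rewrite gt_eqF.
  exists (y' - (dot y' w / dot y w) *: y); last by rewrite E.
  move=> u; rewrite inE => /orP[/eqP ->|us]; rewrite E.
    by rewrite /t divff ?gt_eqF // scale1r subrr dot0r.
  by apply: ys'; apply/mapP; exists u.
Qed.

Lemma in_cone_sum (T : finType) (K : eqType) (g : K -> vec R T) s b : uniq s ->
  in_cone [seq g k | k <- s] b ->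
  exists2 w : K -> R, forall k, 0 <= w k & b = \sum_(k <- s) w k *: g k.
Proof.
elim: s b => [|k s IH] b /=; first by move=> _ ->; exists (fun=> 0); rewrite ?big_nil.
move=> /andP[ks us] [l l0 /(IH _ us)[w w0 H]].
exists (fun i => if i == k then l else w i); first by move=> i; case: ifP.
rewrite big_cons eqxx; apply/eqP; rewrite -subr_eq0 opprD addrA H subr_eq0.
apply/eqP/eq_big_seq => i is_; case: eqP => // E.
by rewrite E (negbTE ks) in is_.
Qed.

Variable T : finType.

Lemma separation (J : finType) (v : J -> vec R T) x : ~ conv v x ->
  exists y, forall x', conv v x' -> dot y x' < dot y x.
Proof.
move=> nx.
pose hom (u : vec R T) : vec R (option T) :=
  [ffun o => if o is Some i then u i else 1].
have dot_hom (y : vec R (option T)) u :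
    dot y (hom u) = dot [ffun i => y (Some i)] u + y None.
  rewrite /dot (bigD1 None) //= !ffunE mulr1 addrC; congr (_ + _).
  rewrite (reindex_omap Some id) => [|[]] //=.
  by apply: eq_big => [i|i _]; rewrite ?eqxx ?ffunE.
have [H|[y ys yx]] := farkas [seq hom (v j) | j <- enum J] (hom x).
  case: nx; have [w w0 E] := in_cone_sum (enum_uniq J) H.
  have EE o : hom x o = \sum_j w j * hom (v j) o.
    rewrite E sum_ffunE big_enum; apply: eq_bigr => j _; by rewrite ffunE.
  exists w; split=> //.
    have := EE None; rewrite ffunE => ->; apply: eq_bigr => j _.
    by rewrite ffunE mulr1.
  apply/ffunP => i; have := EE (Some i); rewrite ffunE => ->.
  by rewrite sum_ffunE; apply: eq_bigr => j _; rewrite !ffunE.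
exists [ffun i => y (Some i)] => x' cx'.
rewrite dot_hom in yx.
have : dot [ffun i => y (Some i)] x' <= - y None.
  apply: conv_dot_le cx' => j; rewrite -subr_le0 opprK -dot_hom; apply: ys.
  by apply/mapP; exists j; rewrite ?mem_enum.
by move=> /le_lt_trans; apply; rewrite -subr_gt0 opprK.
Qed.

(* the maximal face in the direction 1_S is a product of generalized
   permutahedra *)
Lemma face_indicator_prod (S U : {set T}) (p : set (vec R T)) :
  disjoint_sets S U -> is_gp (S :|: U) p ->
  exists A B, [/\ is_gp S A, is_gp U B & face p (indicator R S) = prod_set A B].
Proof.
move=> dSU gp; set a := indicator R S; set F := face p a.
have sS : S \subset S :|: U by exact: finset.subsetUl.
have sU : U \subset S :|: U by exact: finset.subsetUr.
have ca : coord_space (S :|: U) a by exact: indicator_coord.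
have gF : is_gp (S :|: U) F by exact: is_gp_face.
have [sF pF F0 _] := gF.
have aS i j : i \in S :|: U -> j \in S :|: U -> a i = a j ->
    (i \in S) && (j \in S) || (i \in U) && (j \in U).
  rewrite /a !ffunE !inE; case: (i \in S); case: (j \in S) => //= iU jU /eqP;
    rewrite ?oner_eq0 ?[0 == 1]eq_sym ?oner_eq0 // => _; by rewrite iU jU.
have gR (V W : {set T}) : V \subset S :|: U -> S :|: U = V :|: W -> disjoint_sets V W ->
    (forall i j, i \in S :|: U -> j \in S :|: U -> a i = a j ->
      (i \in V) && (j \in V) || (i \in W) && (j \in W)) ->
    is_gp V (restr V @` F).
  move=> sV EV dVW aV; apply/gpP; split.
  - by move=> _ [x _ <-]; exact: restr_coord.
  - exact: polytope_restr.
  - by case: F0 => x Fx; exists (restr V x), x.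
  - move=> z y cz [cy zy] _ [[x Fx <-] m].
    have zx : face F z x.
      split=> // x' Fx'; have := m (restr V x'); rewrite !dot_restrr //; apply.
      by exists x'.
    have : face F y x.
      move: zx; apply: (gp_face_sub gp) => //; [exact: coordS cz|exact: coordS cy|].
      move=> i j iI jI /(aV _ _ iI jI)/orP[]/andP[iV jV]; first exact: zy.
      move=> _; rewrite (cy i) ?(cy j) //.
        by rewrite (disjointFl dVW).
      by rewrite (disjointFl dVW).
    move=> [_ h]; split; first by exists x.
    by move=> _ [x' Fx' <-]; rewrite !dot_restrr //; exact: h.
have dUS : disjoint_sets U S by rewrite disjoint_sym.
exists (restr S @` F), (restr U @` F); split.
- exact: gR dSU _.
- apply: gR dUS _ => //; first by rewrite finset.setUC.
  by move=> i j iI jI /(aS _ _ iI jI); rewrite orbC.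
have restrSU (x : vec R T) : coord_space (S :|: U) x -> restr S x + restr U x = x.
  move=> cx; apply/ffunP => i; rewrite !ffunE.
  have [iS|iS] := boolP (i \in S); first by rewrite (disjointFr dSU) ?addr0.
  rewrite add0r; case: ifPn => // iU; rewrite cx //.
  by rewrite !inE (negbTE iS) (negbTE iU).
apply/seteqP; split => [x Fx|].
  exists (restr S x); first by exists x.
  by exists (restr U x); [exists x|exact/restrSU/sF].
move=> _ [_ [f Ff <-] [_ [g Fg <-] <-]].
set x := (X in F X); apply: contrapT => nFx.
have cx : coord_space (S :|: U) x.
  by apply: coordD; [apply: coordS sS _|apply: coordS sU _]; exact: restr_coord.
have [J [v Ev]] := pF; rewrite Ev in nFx; have [y0 Hy0] := separation nFx.
rewrite -Ev in Hy0.
pose u := restr S y0; pose w := restr U y0.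
have cu : coord_space (S :|: U) u by apply: coordS sS _; exact: restr_coord.
have cw : coord_space (S :|: U) w by apply: coordS sU _; exact: restr_coord.
have Ey x' : coord_space (S :|: U) x' -> dot y0 x' = dot u x' + dot w x'.
  move=> cx'; rewrite -dotDl -(dot_restr y0 cx'); congr dot.
  rewrite -[RHS]restrSU; last exact: coordD.
  rewrite !restrD /u /w (restr_disj dSU (@restr_coord _ _ U y0)).
  rewrite (restr_disj dUS (@restr_coord _ _ S y0)) addr0 add0r.
  apply/ffunP => i; rewrite !ffunE !inE.
  case: (boolP (i \in S)) => iS /=; first by rewrite (disjointFr dSU) ?addr0.
  by rewrite add0r; case: ifP.
have [h [Fh mh]] := polytope_face_neq0 (u + w) pF F0.
have onS i : i \in S -> (u + w) i = u i.
  by move=> iS; rewrite !ffunE iS (disjointFr dSU) // addr0.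
have onU i : i \in U -> (u + w) i = w i.
  by move=> iU; rewrite !ffunE iU (disjointFl dSU) // add0r.
have hu : face F u h.
  apply: (gp_face_sub gp ca (coordD cu cw) cu) => //.
  move=> i j iI jI /(aS _ _ iI jI)/orP[]/andP[iV jV]; first by rewrite !onS.
  by rewrite !ffunE !(disjointFl dSU).
have hw : face F w h.
  apply: (gp_face_sub gp ca (coordD cu cw) cw) => //.
  move=> i j iI jI /(aS _ _ iI jI)/orP[]/andP[iV jV]; last by rewrite !onU.
  by rewrite !ffunE !(disjointFr dSU).
have := Hy0 _ Fh; rewrite (Ey _ cx) (Ey _ (sF _ Fh)) ltNge => /negP; apply.
have dz (V W : {set T}) (b c : vec R T) : disjoint_sets V W ->
    dot (restr V b) (restr W c) = 0.
  move=> dVW; rewrite -(dot_restrr _ (@restr_coord _ _ V b)).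
  by rewrite (restr_disj dVW (@restr_coord _ _ W c)) dot0r.
rewrite /x !dotDr /u /w (dz S U) // (dz U S) // addr0 add0r.
rewrite (dot_restrr _ (@restr_coord _ _ S y0)).
rewrite (dot_restrr _ (@restr_coord _ _ U y0)).
by apply: lerD; [case: hu => _; apply|case: hw => _; apply].
Qed.

End Separation.

Section HopfMonoid.
Variables (R : realType) (T : finType).
Implicit Types (I S U : {set T}).

(* GP[I] *)
Record gp I := GP { gp_set :> set (vec R T); gp_valid : is_gp I gp_set }.

HB.instance Definition _ I := gen_eqMixin (gp I).
HB.instance Definition _ I := gen_choiceMixin (gp I).

Lemma gp_inj I : injective (@gp_set I).
Proof. by move=> [p hp] [q hq] /= E; subst q; congr GP; exact: Prop_irrelevance. Qed.

Definition gp_origin I : gp I := GP (is_gp_origin R I).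

Definition gp_prod S U (p : gp S) (q : gp U) : gp (S :|: U) :=
  GP (is_gp_prod (gp_valid p) (gp_valid q)).

(* the pair (p|_S, p/_S) determined by p_(1_S) = p|_S x p/_S ; by the two lemmas
   below it exists and is unique when S and U are disjoint *)
Definition gp_coprod S U (p : gp (S :|: U)) : gp S * gp U :=
  xget (gp_origin S, gp_origin U)
    [set ab : gp S * gp U | face p (indicator R S) = prod_set ab.1 ab.2].

Lemma gp_coprodP S U (p : gp (S :|: U)) : disjoint_sets S U ->
  face p (indicator R S) = prod_set (gp_coprod p).1 (gp_coprod p).2.
Proof.
move=> dSU; have [A [B [gA gB E]]] := face_indicator_prod dSU (gp_valid p).
exact: (@xgetI _ (gp_origin S, gp_origin U)
  [set ab : gp S * gp U | face p (indicator R S) = prod_set ab.1 ab.2]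
  (GP gA, GP gB)).
Qed.

Lemma prod_set_inj S U (a a' : gp S) (b b' : gp U) : disjoint_sets S U ->
  prod_set a b = prod_set a' b' -> a = a' /\ b = b'.
Proof.
move=> dSU E.
have restr_prod (c : gp S) (d : gp U) :
    (restr S @` prod_set c d = c) /\ (restr U @` prod_set c d = d).
  have [sc _ [x0 cx0] _] := gp_valid c; have [sd _ [y0 dy0] _] := gp_valid d.
  have rS x y : gp_set c x -> gp_set d y -> restr S (x + y) = x.
    by move=> /sc ? /sd ?; rewrite restrD restr_id // (restr_disj dSU) ?addr0.
  have rU x y : gp_set c x -> gp_set d y -> restr U (x + y) = y.
    move=> /sc ? /sd ?; rewrite restrD addrC restr_id //.
    by rewrite (@restr_disj _ _ U S) ?addr0 // disjoint_sym.
  split; apply/seteqP; split=> x.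
  - by move=> [_ [u cu [v dv <-]] <-]; rewrite rS.
  - by move=> cx; exists (x + y0); [exists x => //; exists y0|rewrite rS].
  - by move=> [_ [u cu [v dv <-]] <-]; rewrite rU.
  - by move=> dx; exists (x0 + x); [exists x0 => //; exists x|rewrite rU].
have [Ha Hb] := restr_prod a b; have [Ha' Hb'] := restr_prod a' b'.
by split; apply: gp_inj; [rewrite -Ha -Ha' E|rewrite -Hb -Hb' E].
Qed.

(* A nonempty sequence of blocks S_1, ..., S_k is given by its head S_1 and its
   tail; the basis of GP[S_1] (x) ... (x) GP[S_k] is GP[S_1] x ... x GP[S_k]. *)
Fixpoint blocks_union S (Ss : seq {set T}) : {set T} :=
  if Ss is S' :: Ss' then S :|: blocks_union S' Ss' else S.

Fixpoint tensor_basis S (Ss : seq {set T}) : choiceType :=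
  if Ss is S' :: Ss' then (gp S * tensor_basis S' Ss')%type else gp S.

Fixpoint iter_prod S Ss : tensor_basis S Ss -> gp (blocks_union S Ss) :=
  match Ss with
  | [::] => fun p => p
  | S' :: Ss' => fun ps => gp_prod ps.1 (@iter_prod S' Ss' ps.2)
  end.

Fixpoint iter_coprod S Ss : gp (blocks_union S Ss) -> tensor_basis S Ss :=
  match Ss with
  | [::] => fun p => p
  | S' :: Ss' => fun p =>
      ((gp_coprod p).1, @iter_coprod S' Ss' (gp_coprod p).2)
  end.

Definition set_composition I S (Ss : seq {set T}) : bool :=
  [&& finset.set0 \notin S :: Ss,
      pairwise (fun A B : {set T} => disjoint_sets A B) (S :: Ss) &
      blocks_union S Ss == I].

(* ordered sequences of k.+1 nonempty disjoint blocks with union I *)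
Definition compositions I k :=
  {s : {set T} * k.-tuple {set T} | set_composition I s.1 s.2}.

Lemma compositions_union I k (s : compositions I k) :
  blocks_union (val s).1 (val s).2 = I.
Proof. by case: s => s /= /and3P[_ _ /eqP]. Qed.

Variable k : fieldType.

(* the vector space GP[I] *)
Definition GPvect I := {freeg (gp I) / k}.

Definition basis_elt I (p : gp I) : GPvect I := << p >>.

Definition linear_ext (A B : choiceType) (f : A -> B)
    (v : {freeg A / k}) : {freeg B / k} :=
  fglift (fun a => << f a >>) v.

Definition mu S Ss : {freeg (tensor_basis S Ss) / k} ->
    GPvect (blocks_union S Ss) :=
  linear_ext (@iter_prod S Ss).

Definition Delta S Ss : GPvect (blocks_union S Ss) ->
    {freeg (tensor_basis S Ss) / k} :=
  linear_ext (@iter_coprod S Ss).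

(* mu o Delta for the blocks of s, transported along the equality between their
   union and I *)
Definition mu_Delta I n (s : compositions I n) : GPvect I -> GPvect I :=
  ecast J (GPvect J -> GPvect J) (compositions_union s)
    (fun v => mu (@Delta (val s).1 (val s).2 v)).

(* the blocks being nonempty and disjoint, there are at most #|I| of them *)
Definition antipode I (v : GPvect I) : GPvect I :=
  if I == finset.set0 then v
  else \sum_(n < #|I|) \sum_(s : compositions I n) (-1) ^+ n.+1 *: mu_Delta s v.

(* all nonempty faces of p, which lie in GP[I] by is_gp_face *)
Definition faces I (p : gp I) : set (gp I) := [set q : gp I | is_face I p q].

End HopfMonoid.

(* Formulas \sum_(a in A) c a x_a with integer coefficients. *)
Definition cancellation_free (J X : Type) (A : set J) (c : J -> int)
    (x : J -> X) :=
  forall a b, A a -> A b -> a <> b -> ~ (x a = x b /\ c a * c b < 0).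

Definition grouping_free (J X : Type) (A : set J) (x : J -> X) :=
  forall a b, A a -> A b -> a <> b -> x a <> x b.

(* Main.v *)
Require Import Defs.
From HB Require Import structures.
From mathcomp Require Import all_boot all_order all_algebra.
From mathcomp Require Import boolp classical_sets functions cardinality fsbigop.
From mathcomp Require Import reals.
From mathcomp Require Import freeg.
From mathcomp Require Import ring lra.

Import Order.TTheory GRing.Theory Num.Theory.

Local Open Scope classical_set_scope.
Local Open Scope ring_scope.

(** The coefficient of a basis element q in the antipode of p is the sum of
    (-1)^k over the ordered set compositions (S_1, ..., S_k) of I for which
    mu o Delta sends p to q.  Such a composition names a cell of the braid
    arrangement, the one of the vectors that are constant on each block and
    decrease from each block to the next, and iterating the coproduct computes
    the face p_y for y in that cell [face_iter_coprod].  Hence only faces of p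
    occur, and the coefficient of a face q is the sum of (-1)^(dim F) over the
    braid cells F contained in C_q = {y in R^I : p_y = q}, that is,
    the compactly supported Euler characteristic of C_q.

    The set C_q is a convex cone, it is a union of braid cells because p is a
    generalized permutahedron, and it is relatively open: its span W is the
    orthogonal complement of the directions of q in R^I, and moving y in C_q
    slightly along w in W replaces p_y = q by its face q_w, which is q since w
    is constant on q.  So dim W = |I| - dim q [face_open_braid_cone].

    It remains to see that the alternating sum of the cells of a relatively open
    convex cone C that is a union of cells is (-1)^(dim C) [obc_euler].  This
    goes by induction on the number of cells.  If C has at least two cells, two
    points of C are on different sides of some hyperplane y_a = y_b, and as C is
    relatively open it has points strictly on both sides.  The hyperplane cuts C
    into two open halves of the same dimension and a slice of dimension one
    less, each with fewer cells, and
    (-1)^d + (-1)^d + (-1)^(d-1) = (-1)^d.  If C is a single cell, its dimension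
    is the number of blocks of the corresponding composition [obc_single].

    Each face thus has a single coefficient, which makes the formula
    cancellation-free and grouping-free. *)

Set Implicit Arguments.
Unset Strict Implicit.
Unset Printing Implicit Defensive.

(** * Subspaces of R^T *)

Section LinearAlgebra.
Variables (R : realType) (T : finType).
Implicit Types (U V W D : {vspace vec R T}) (x y w : vec R T).

Lemma dimv_cap_lker1 W (f : 'Hom(vec R T, R^o)) w :
  w \in W -> f w != 0 -> \dim W = (\dim (W :&: lker f)).+1.
Proof.
move=> wW fw; rewrite -(limg_ker_dim f W).
suff -> : \dim (f @: W) = 1%N by rewrite addn1.
apply/eqP; rewrite eqn_leq lt0n dimv_eq0; apply/andP; split.
  by apply: leq_trans (dimvS (subvf _)) _; rewrite dimvf.
apply: contra fw => /eqP fW0; have := memv_img f wW.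
by rewrite fW0 memv0.
Qed.

(** The complement is the kernel in U of the map w |-> (w . b_j)_j for a basis
    (b_j) of D.  Rank-nullity bounds its dimension from below; it meets D
    trivially as the dot product is positive definite, which bounds its
    dimension from above. *)
Lemma orthogonal_complement U D : (D <= U)%VS ->
  exists W, [/\ (W <= U)%VS,
    forall w, (w \in W) = (w \in U) && `[< forall x, x \in D -> dot w x = 0 >] &
    (\dim W + \dim D = \dim U)%N].
Proof.
move=> sDU; pose b := vbasis D.
pose f y : {ffun 'I_(\dim D) -> R^o} := [ffun j : 'I_(\dim D) => dot y b`_j].
have f_lin : linear f.
  by move=> a x y; apply/ffunP => j; rewrite !ffunE dotDl dotZl.
pose F : {linear vec R T -> {ffun 'I_(\dim D) -> R^o}} :=
  HB.pack f (GRing.isLinear.Build _ _ _ _ f f_lin).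
pose phi := linfun F.
have kerP w : reflect (forall x, x \in D -> dot w x = 0) (w \in lker phi).
  rewrite memv_ker lfunE /=; apply: (iffP eqP) => [fw x xD|h].
    rewrite (coord_vbasis xD) dot_sumr big1 // => j _.
    by have /ffunP/(_ j) := fw; rewrite !ffunE => ->; rewrite mulr0.
  apply/ffunP => j; rewrite !ffunE; apply: h; apply/vbasis_mem/mem_nth.
  by rewrite size_tuple.
have capE w : (w \in (U :&: lker phi)%VS) =
    (w \in U) && `[< forall x, x \in D -> dot w x = 0 >].
  rewrite memv_cap; congr (_ && _).
  by apply/kerP/asboolP.
exists (U :&: lker phi)%VS; split=> //; first exact: capvSl.
have disj : (U :&: lker phi :&: D = 0)%VS.
  apply/eqP; rewrite -subv0; apply/subvP => x; rewrite memv_cap capE memv0.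
  move=> /andP[/andP[_ /asboolP h] xD]; apply: contraT => /dot_gt0.
  by rewrite h // ltxx.
apply/eqP; rewrite eqn_leq -dimv_disjoint_sum // dimvS /=; last first.
  by rewrite subv_add capvSl.
rewrite dimv_disjoint_sum // -(limg_ker_dim phi U) leq_add2l.
apply: leq_trans (dimvS (subvf _)) _.
by rewrite dimvf /dim /= card_ord muln1.
Qed.

(** The functions on T constant on the fibres of h and zero where h = None are
    the pullbacks of the functions on J, so they form a space of dimension
    #|J|.  This computes the dimension both of R^I (h is the partial inverse of
    the inclusion of I) and of a braid cell (h is the index of the block). *)
Lemma fibre_space (J : finType) (h : T -> option J) :
  (forall j, exists i, h i = Some j) ->
  exists W, \dim W = #|J| /\ forall w, w \in W <->
    (forall i, h i = None -> w i = 0) /\ (forall i j, h i = h j -> w i = w j).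
Proof.
move=> /choice[e he].
pose f (g : {ffun J -> R^o}) : vec R T := [ffun i => oapp g 0 (h i)].
have f_lin : linear f.
  move=> a x y; apply/ffunP => i; rewrite !ffunE; case: (h i) => [j|] /=.
    by rewrite !ffunE.
  by rewrite scaler0 addr0.
pose F : {linear {ffun J -> R^o} -> vec R T} :=
  HB.pack f (GRing.isLinear.Build _ _ _ _ f f_lin).
exists (limg (linfun F)); split.
  rewrite limg_dim_eq; first by rewrite dimvf /dim /= muln1.
  rewrite capfv; apply/eqP/lker0P => g g'; rewrite !lfunE /= => E.
  apply/ffunP => j; have /ffunP/(_ (e j)) := E.
  by rewrite !ffunE he.
move=> w; split.
  move=> /memv_imgP[g _ ->]; rewrite lfunE /=; split => [i|i j] hi.
    by rewrite ffunE hi.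
  by rewrite !ffunE hi.
move=> [w0 wh]; apply/memv_imgP; exists [ffun j => w (e j)]; first exact: memvf.
rewrite lfunE; apply/ffunP => i; rewrite ffunE; case E: (h i) => [j|] /=.
  by rewrite ffunE; apply: wh; rewrite he.
exact: w0.
Qed.

Lemma coord_vspace (I : {set T}) : exists U : {vspace vec R T},
  \dim U = #|I| /\ forall w, w \in U <-> coord_space I w.
Proof.
have [i|U [dU UE]] := @fibre_space {i | i \in I} (insub : T -> option {i | i \in I}).
  by exists (val i); rewrite valK.
exists U; split=> [|w]; first by rewrite dU card_sig.
rewrite UE; split=> [[w0 _] i iI|w0]; first by apply: w0; rewrite insubN.
split=> [i|i j].
  by case: insubP => // iI _; apply: w0.
case: insubP => [u _ <-|iI]; case: insubP => [v _ <-|jI] //.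
  by move=> [->].
by rewrite !w0.
Qed.

End LinearAlgebra.

(** * Ordered set compositions *)

Section Compositions.
Variable T : finType.
Implicit Types (I S B : {set T}) (Bs : seq {set T}).

(** Ordered set compositions of I, in a form suited to induction: the first block
    S_1 is removed from I, and the others form a composition of what is left. *)
Fixpoint composition I Bs : bool :=
  if Bs is B :: Bs' then
    [&& B != finset.set0, B \subset I & composition (I :\: B) Bs']
  else I == finset.set0.

(** The blocks S_1, ..., S_k have levels k, ..., 1: the coproduct takes the face
    maximal on 1_(S_1) first, so S_1 must come on top.  Level 0 is left for the
    complement of I, so that the levels give a vector of R^I. *)
Fixpoint level Bs (i : T) : nat :=
  if Bs is B :: Bs' then if i \in B then (size Bs').+1 else level Bs' i
  else 0.

Lemma disjoint_blocks_union S B Bs :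
  disjoint_sets S (blocks_union B Bs) =
  all (fun A : {set T} => disjoint_sets S A) (B :: Bs).
Proof.
elim: Bs B => [|B' Bs IH] B; first by rewrite /= andbT.
have -> : all (fun A : {set T} => disjoint_sets S A) [:: B, B' & Bs] =
    disjoint_sets S B && disjoint_sets S (blocks_union B' Bs) by rewrite IH.
by rewrite -!finset.setI_eq0 finset.setIUr finset.setU_eq0.
Qed.

Lemma set_composition_rec I S Bs : set_composition I S Bs = composition I (S :: Bs).
Proof.
rewrite /set_composition; elim: Bs I S => [|B Bs IH] I S.
  rewrite /= inE [_ == S]eq_sym; case: eqP => //= _.
  by rewrite finset.eqEsubset finset.setD_eq0.
rewrite [RHS]/= -/(composition _ (B :: Bs)) -IH.
rewrite [blocks_union S _]/= pairwise_cons -disjoint_blocks_union in_cons negb_or.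
rewrite [_ == S]eq_sym; set U := blocks_union B Bs.
have [//|S0 /=] := eqVneq S finset.set0.
suff E : disjoint_sets S U && (S :|: U == I) = (S \subset I) && (U == I :\: S).
  case: (_ \notin _); case: (all _ _); case: (pairwise _ _);
    by rewrite /= ?andbF // andbT.
apply/idP/idP => [/andP[dSU /eqP <-]|/andP[SI /eqP E]].
  rewrite finset.subsetUl /= finset.setDUl finset.setDv finset.set0U.
  apply/eqP/esym/finset.setDidPl.
  by rewrite disjoint_sym.
rewrite E -finset.setI_eq0 finset.setIDA; apply/andP; split.
  by rewrite finset.setD_eq0 finset.subsetIl.
by have := finset.setID I S; rewrite (finset.setIidPr SI) => ->.
Qed.

Lemma level_le_size Bs i : (level Bs i <= size Bs)%N.
Proof. by elim: Bs => //= B Bs IH; case: ifP => // _; apply: leqW. Qed.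

Lemma level_gt0 I Bs i : composition I Bs -> (0 < level Bs i)%N = (i \in I).
Proof.
elim: Bs I => [|B Bs IH] I /=; first by move/eqP ->; rewrite inE.
move=> /and3P[_ /fintype.subsetP BI /IH]; case: ifPn => [/BI ->//|iB ->].
by rewrite inE iB.
Qed.

Lemma level_onto I Bs l : composition I Bs -> (0 < l <= size Bs)%N ->
  exists i, level Bs i = l.
Proof.
elim: Bs I => [|B Bs IH] I /= => [_|/and3P[/finset.set0Pn[b bB] _ cBs]].
  by rewrite leqn0 andbC; case: eqP => // ->.
rewrite [X in _ && X]leq_eqVlt => /andP[l0 /orP[/eqP ->|lt]].
  by exists b; rewrite bB.
have [|i li] := IH _ cBs; first by rewrite l0.
exists i; rewrite li; case: ifPn => // iB.
have := level_gt0 i cBs; rewrite li l0 => /esym.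
by rewrite inE iB.
Qed.

Lemma size_composition I Bs : composition I Bs -> (size Bs <= #|I|)%N.
Proof.
elim: Bs I => [//|B Bs IH] I /= /and3P[B0 BI /IH].
rewrite finset.cardsDS // => h.
rewrite -card_gt0 in B0; rewrite (leq_ltn_trans h) // ltn_subrL B0.
by apply: leq_trans B0 _; apply: fintype.subset_leq_card.
Qed.

(** The first block can be read off the preorder that the levels induce on I;
    this is why the preorder determines the composition [level_inj]. *)
Lemma top_block I B Bs i : composition I (B :: Bs) ->
  (i \in B) = (i \in I) &&
    [forall j in I, (level (B :: Bs) j <= level (B :: Bs) i)%N].
Proof.
move=> /and3P[/finset.set0Pn[b bB] /fintype.subsetP BI _].
apply/idP/andP => [iB|[iI /forall_inP h]].
  split; first exact: BI.
  by apply/forall_inP => j _; rewrite [leqRHS]/= iB; exact: level_le_size (B :: Bs) j.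
have := h b (BI b bB); rewrite /= bB; case: ifP => // _.
by rewrite ltnNge level_le_size.
Qed.

Lemma level_inj I Bs Bs' : composition I Bs -> composition I Bs' ->
  {in I &, forall i j, (level Bs i <= level Bs j)%N = (level Bs' i <= level Bs' j)%N} ->
  Bs = Bs'.
Proof.
elim: Bs I Bs' => [|B Bs IH] I [|B' Bs'] // cB cB' h.
- move: cB cB' => /= /eqP -> /and3P[/finset.set0Pn[b bB] /fintype.subsetP BI _].
  by have := BI _ bB; rewrite inE.
- move: cB' cB => /= /eqP -> /and3P[/finset.set0Pn[b bB] /fintype.subsetP BI _].
  by have := BI _ bB; rewrite inE.
have EB : B = B'.
  apply/finset.setP => i; rewrite (top_block _ cB) (top_block _ cB').
  have [iI|//] := boolP (i \in I); congr andb.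
  by apply: eq_forallb_in => j jI; apply: h.
subst B'; congr cons; apply: (IH (I :\: B)); [by case/and3P: cB|by case/and3P: cB'|].
move=> i j; rewrite !inE => /andP[iB iI] /andP[jB jI].
by have := h _ _ iI jI; rewrite /= (negbTE iB) (negbTE jB).
Qed.

End Compositions.

(** * Cells of the braid arrangement *)

Section BraidCells.
Variables (R : realType) (T : finType).
Implicit Types (I : {set T}) (Bs : seq {set T}) (y z w : vec R T).

Definition same_cell I y z := {in I &, forall i j, (y i <= y j) = (z i <= z j)}.

Lemma same_cell_eq I y z i j : same_cell I y z -> i \in I -> j \in I ->
  (y i == y j) = (z i == z j).
Proof. by move=> h iI jI; rewrite !eq_le !h. Qed.

Definition level_vec Bs : vec R T := [ffun i => (level Bs i)%:R].

Lemma level_vec_le Bs i j :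
  (level_vec Bs i <= level_vec Bs j) = (level Bs i <= level Bs j)%N.
Proof. by rewrite !ffunE ler_nat. Qed.

Lemma level_vec_coord I Bs : composition I Bs -> coord_space I (level_vec Bs).
Proof.
by move=> cB i; rewrite -(level_gt0 _ cB) ffunE -eqn0Ngt => /eqP ->.
Qed.

(** The first block collects the indices where y is maximal, and so on. *)
Lemma level_vec_exists I y : exists2 Bs, composition I Bs &
  same_cell I y (level_vec Bs).
Proof.
have [n leIn] := ubnP #|I|; elim: n => // n IH in I leIn *.
have [->|/finset.set0Pn[i0 i0I]] := eqVneq I finset.set0.
  by exists [::] => [/=|i j]; rewrite ?inE.
pose B := [set i in I | [forall j in I, y j <= y i]]%SET.
have BI : B \subset I by apply/fintype.subsetP => i; rewrite inE => /andP[].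
have [b bB] : exists b, b \in B.
  have [b bI bmax] := arg_maxP y i0I.
  exists b; rewrite inE; apply/andP; split; first exact: bI.
  by apply/forall_inP => j /bmax.
have [|Bs cBs h] := IH (I :\: B).
  rewrite ltnS in leIn; apply: leq_trans leIn; apply: proper_card.
  apply/fintype.properP; split; first exact: finset.subsetDl.
  by exists b; [exact: (fintype.subsetP BI)|rewrite inE bB].
exists (B :: Bs); first by rewrite /= BI cBs !andbT; apply/finset.set0Pn; exists b.
move=> i j iI jI; rewrite level_vec_le /=.
have [iB|iB] := boolP (i \in B); have [jB|jB] := boolP (j \in B).
- by rewrite leqnn; move: jB; rewrite inE => /andP[_ /forall_inP ->].
- rewrite ltnNge level_le_size; apply/negbTE; apply: contra jB => le_ij.
  rewrite inE jI; apply/forall_inP => l lI; apply: le_trans le_ij.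
  by move: iB; rewrite inE => /andP[_ /forall_inP ->].
- rewrite (leqW (level_le_size _ _)).
  by move: jB; rewrite inE => /andP[_ /forall_inP ->].
- by rewrite h ?level_vec_le // inE ?iB ?jB.
Qed.

Lemma level_vec_span I Bs : composition I Bs -> exists W : {vspace vec R T},
  \dim W = size Bs /\ forall w, w \in W <-> coord_space I w /\
    {in I &, forall i j, level_vec Bs i = level_vec Bs j -> w i = w j}.
Proof.
move=> cB.
pose h i : option 'I_(size Bs) := if level Bs i is l.+1 then insub l else None.
have hS i : i \in I -> exists2 u : 'I_(size Bs), h i = Some u & level Bs i = u.+1.
  rewrite -(level_gt0 _ cB) /h; have := level_le_size Bs i.
  by case: level => // l ltl _; exists (Ordinal ltl); rewrite // insubT.
have hN i : i \notin I -> h i = None.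
  by rewrite -(level_gt0 _ cB) /h; case: level.
have [u|W [dW WE]] := @fibre_space R T _ h.
  have [i li] := level_onto (l := u.+1) cB (ltn_ord u).
  by exists i; rewrite /h li; exact: valK u.
exists W; split=> [|w]; first by rewrite dW card_ord.
rewrite WE; split=> -[w0 wh]; split.
- by move=> i /hN; apply: w0.
- move=> i j iI jI; rewrite !ffunE => /eqP; rewrite eqr_nat => /eqP E.
  by apply: wh; rewrite /h E.
- by move=> i hi; apply: w0; apply: contraPN hi => /hS[u ->].
- move=> i j; have [iI|/[dup]iI /hN ->] := boolP (i \in I).
    have [u -> lu] := hS i iI; have [jI|/hN -> //] := boolP (j \in I).
    have [v -> lv] := hS j jI; move=> [E].
    by apply: wh; rewrite // !ffunE lu lv E.
  have [/hS[u ->]//|jI _] := boolP (j \in I).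
  by rewrite !w0.
Qed.

(** The relatively open convex cones C with linear span W that are unions of
    cells.  That W is spanned by C follows from [obc_open]; as W is kept
    explicit, its dimension serves as the dimension of C. *)
Record open_braid_cone I (C : set (vec R T)) (W : {vspace vec R T}) : Prop :=
    OpenBraidCone {
  obc_neq0 : C !=set0;
  obc_span : forall y, C y -> y \in W;
  obc_coord : forall w, w \in W -> coord_space I w;
  obc_cone : forall y z a b,
    C y -> C z -> 0 < a -> 0 < b -> C (a *: y + b *: z);
  obc_open : forall y w, C y -> w \in W ->
    exists2 e, 0 < e & forall t, 0 < t <= e -> C (y + t *: w);
  obc_cell : forall y z, C y -> coord_space I z -> same_cell I y z -> C z }.

Lemma obc_half I C W a b : a \in I -> b \in I -> open_braid_cone I C W ->
  (exists2 y, C y & y a < y b) ->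
  open_braid_cone I (C `&` [set y | y a < y b]) W.
Proof.
move=> aI bI [C0 Cs Cc Ca Co Cl] [y0 Cy0 l0]; split.
- by exists y0.
- by move=> y [/Cs].
- exact: Cc.
- move=> y z s t [Cy yl] [Cz zl] s0 t0; split; first exact: Ca.
  by rewrite /= !ffunE ltrD // /GRing.scale /= ltr_pM2l.
- move=> y w [Cy yl] wW; have [e e0 he] := Co _ _ Cy wW.
  have [e' e'0 he'] := small_lt (w a - w b) yl.
  exists (Num.min e e') => [|t]; first by rewrite lt_min e0.
  rewrite le_min => /and3P[t0 te te']; split; first by apply: he; rewrite t0.
  have := he' t; rewrite t0 te' /= !ffunE /GRing.scale /= => /(_ isT).
  by rewrite mulrBr; lra.
- move=> y z [Cy yl] zI yz; split; first exact: Cl yz.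
  by move: yl; rewrite /= !ltNge yz.
Qed.

Fact coord_diff_linear a b : linear (fun y : vec R T => y a - y b : R^o).
Proof. by move=> s x y; rewrite !ffunE scalerBr addrACA opprD. Qed.

Definition coord_diff a b : 'Hom(vec R T, R^o) :=
  linfun (HB.pack_for {linear vec R T -> R^o} (fun y : vec R T => y a - y b : R^o)
    (GRing.isLinear.Build _ _ _ _ _ (coord_diff_linear a b))).

Lemma coord_diffE a b y : coord_diff a b y = y a - y b.
Proof. by rewrite lfunE. Qed.

Lemma obc_slice I C W a b : a \in I -> b \in I -> open_braid_cone I C W ->
  (exists2 y, C y & y a = y b) ->
  open_braid_cone I (C `&` [set y | y a = y b]) (W :&: lker (coord_diff a b)).
Proof.
move=> aI bI [C0 Cs Cc Ca Co Cl] [y0 Cy0 l0].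
have inW w : w \in (W :&: lker (coord_diff a b))%VS = (w \in W) && (w a == w b).
  by rewrite memv_cap memv_ker coord_diffE subr_eq0.
split.
- by exists y0.
- by move=> y [Cy yl]; rewrite inW Cs //; apply/eqP.
- by move=> w; rewrite inW => /andP[/Cc].
- move=> y z s t [Cy yl] [Cz zl] s0 t0; split; first exact: Ca.
  by rewrite /= !ffunE yl zl.
- move=> y w [Cy yl]; rewrite inW => /andP[wW /eqP wl].
  have [e e0 he] := Co _ _ Cy wW.
  exists e => // t te; split; first exact: he.
  by rewrite /= !ffunE yl wl.
- move=> y z [Cy yl] zI yz; split; first exact: Cl yz.
  by apply/eqP; rewrite /= -(same_cell_eq yz) //; apply/eqP.
Qed.

End BraidCells.

(** * Euler characteristic of a relatively open convex union of cells *)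

Section Euler.
Variables (R : realType) (T : finType) (I : {set T}).

Definition comps := {n : 'I_#|I| & compositions I n}.

Definition blocks (s : comps) : seq {set T} :=
  (val (tagged s)).1 :: (val (tagged s)).2.

Lemma blocksP s : composition I (blocks s).
Proof. by case: s => n [[S Ss] h]; have := h; rewrite set_composition_rec. Qed.

Lemma size_blocks s : size (blocks s) = (tag s).+1.
Proof. by rewrite /= size_tuple. Qed.

(** A composition of I has at most #|I| blocks, so the bound on the number of
    blocks in [comps] excludes nothing. *)
Lemma blocks_onto Bs : I != finset.set0 -> composition I Bs -> exists s, blocks s = Bs.
Proof.
case: Bs => [|S Ss] I0 cB; first by rewrite (eqP cB) eqxx in I0.
have ltn : (size Ss < #|I|)%N by exact: (size_composition cB).
have cS : set_composition I (S, in_tuple Ss).1 (S, in_tuple Ss).2.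
  by rewrite set_composition_rec.
by exists (existT (fun n : 'I_#|I| => compositions I n) (Ordinal ltn)
  (exist (fun s : {set T} * (size Ss).-tuple {set T} => set_composition I s.1 s.2)
     (S, in_tuple Ss) cS)).
Qed.

Lemma blocks_inj : injective blocks.
Proof.
move=> [n s] [n' s'] E; have En : n = n'.
  by apply: val_inj; have := congr1 size E; rewrite !size_blocks => -[].
subst n'; congr existT; apply: val_inj.
case: s E => [[S Ss] h]; case: s' => [[S' Ss'] h'].
by rewrite /blocks /= => -[-> /val_inj ->].
Qed.

Implicit Types (C : set (vec R T)) (W : {vspace vec R T}).

Definition cell s : vec R T := level_vec R (blocks s).

Lemma cell_coord s : coord_space I (cell s).
Proof. exact/level_vec_coord/blocksP. Qed.

Lemma cell_inj s s' : same_cell I (cell s) (cell s') -> s = s'.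
Proof.
move=> h; apply/blocks_inj/(level_inj (blocksP s) (blocksP s')) => i j iI jI.
by rewrite -!(level_vec_le R) h.
Qed.

Lemma cell_exists y : I != finset.set0 -> exists s, same_cell I y (cell s).
Proof.
move=> I0; have [Bs cB yB] := level_vec_exists I y.
by have [s sB] := blocks_onto I0 cB; exists s; rewrite /cell sB.
Qed.

Lemma obc_cell_mem C W : I != finset.set0 -> open_braid_cone I C W ->
  exists s, C (cell s).
Proof.
move=> I0 CW; have [y Cy] := obc_neq0 CW.
have [s ys] := cell_exists y I0; exists s.
exact (obc_cell CW Cy (cell_coord s) ys).
Qed.

(** If C is a single cell then small perturbations of it inside W stay in this
    cell, so W consists of vectors constant on the blocks; conversely, adding a
    small vector constant on the blocks does not change the cell. *)
Lemma obc_single C W s : open_braid_cone I C W ->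
  C (cell s) -> (forall s', C (cell s') -> s' = s) ->
  \dim W = size (blocks s).
Proof.
move=> CW Cs uniq; have [V [<- VE]] := @level_vec_span R T I _ (blocksP s).
have I0 : I != finset.set0.
  by rewrite -card_gt0; exact: leq_ltn_trans (leq0n _) (ltn_ord (tag s)).
suff -> : W = V by [].
apply/eqP; rewrite eqEsubv; apply/andP; split; apply/subvP => w wV.
  have [e e0 he] := obc_open CW Cs wV.
  apply/VE; split=> [|i j iI jI ij]; first exact: (obc_coord CW).
  have Cy : C (cell s + e *: w) by apply: he; rewrite e0 lexx.
  have [s' ss'] := cell_exists (cell s + e *: w) I0.
  have E : s' = s by exact: uniq _ (obc_cell CW Cy (cell_coord s') ss').
  rewrite E in ss'; have := same_cell_eq ss' iI jI.
  rewrite !ffunE; move: ij; rewrite !ffunE => ->; rewrite eqxx => /eqP/addrI/mulfI.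
  by apply; rewrite gt_eqF.
move/VE: wV => [w0 wh].
have h1 : {in I &, forall i j, cell s i = cell s j ->
    (0 : vec R T) i <= (0 : vec R T) j -> w i <= w j}.
  by move=> i j iI jI /wh-> //.
have h2 : {in I &, forall i j, cell s i = cell s j ->
    w i <= w j -> (0 : vec R T) i <= (0 : vec R T) j}.
  by move=> i j iI jI _ _; rewrite !ffunE.
have [e1 e10 he1] := braid_perturb h1; have [e2 e20 he2] := braid_perturb h2.
pose e := Num.min e1 e2.
have e0 : 0 < e by rewrite lt_min e10.
have he : same_cell I (cell s) (cell s + e *: w).
  move=> i j iI jI; apply/idP/idP.
    have := he1 e _ _ _ iI jI; rewrite e0 ge_min lexx /= !ffunE !mulr0 !addr0.
    exact.
  have := he2 e _ _ _ iI jI; rewrite e0 ge_min lexx orbT /= !ffunE !mulr0 !addr0.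
  exact.
have Cw : C (cell s + e *: w).
  by apply: (obc_cell CW Cs) he; apply/coordD/coordZ => //; exact: cell_coord.
have := memvB (obc_span CW Cw) (obc_span CW Cs).
rewrite addrC addKr => /(memvZ e^-1); rewrite scalerA mulVf ?gt_eqF //.
by rewrite scale1r.
Qed.

(** Cutting C by a hyperplane y_a = y_b that separates two of its points gives
    three cones with fewer cells. *)
Lemma obc_euler (A : pzRingType) C W : I != finset.set0 -> open_braid_cone I C W ->
  \sum_(s | `[< C (cell s) >]) (-1) ^+ size (blocks s) = (-1) ^+ \dim W :> A.
Proof.
move=> I0; pose chi C : A := \sum_(s | `[< C (cell s) >]) (-1) ^+ size (blocks s).
pose N C := #|[pred s | `[< C (cell s) >]]|.
have [n leN] := ubnP (N C); elim: n => // n IH in C W leN * => CW.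
have [s Cs] := obc_cell_mem I0 CW.
have [uniq|] := pselect (forall s', C (cell s') -> s' = s).
  rewrite (obc_single CW Cs uniq) (big_pred1 s) // => s'.
  by apply/asboolP/eqP => [/uniq|->].
move=> /existsNP[s' /not_implyP[Cs' ss']].
have [a [b [aI bI nle le']]] : exists a b, [/\ a \in I, b \in I,
    exists2 y, C y & y a < y b & exists2 y, C y & y b < y a].
  (* from y, where y_a <= y_b, a small step away from z makes the inequality
     strict *)
  have separate y z a b : a \in I -> b \in I -> C y -> C z ->
      y a <= y b -> z b < z a -> exists2 y, C y & y a < y b.
    move=> aI bI Cy Cz ley ltz.
    have [e e0 he] := obc_open CW Cy (memvB (obc_span CW Cy) (obc_span CW Cz)).
    exists (y + e *: (y - z)); first by apply: he; rewrite e0 lexx.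
    rewrite !ffunE /GRing.scale /=; nra.
  have : exists a b, [/\ a \in I, b \in I &
      (cell s a <= cell s b) != (cell s' a <= cell s' b)].
    apply: contrapT => H; apply: ss'; apply: cell_inj => a b aI bI.
    by apply/eqP; apply: contrapT => /negP E; apply: H; exists a, b; rewrite eq_sym.
  move=> [a [b [aI bI]]].
  have [le1|lt1] := leP (cell s a) (cell s b);
    have [le2|lt2] := leP (cell s' a) (cell s' b) => // _.
    exists a, b; split=> //; last by exists (cell s').
    exact: separate le1 lt2.
  exists a, b; split=> //; last by exists (cell s).
  exact: separate le2 lt1.
(* a positive multiple of the point where the segment from y to z meets the
   hyperplane *)
have Ceq : exists2 y, C y & y a = y b.
  have [y Cy yl] := nle; have [z Cz zl] := le'.
  exists ((z a - z b) *: y + (y b - y a) *: z).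
    by apply: (obc_cone CW); rewrite // subr_gt0.
  by rewrite !ffunE /GRing.scale /=; ring.
have Hlt := obc_half aI bI CW nle; have Hgt := obc_half bI aI CW le'.
have Heq := obc_slice aI bI CW Ceq.
have smaller (P Q : set (vec R T)) V : P `&` Q = set0 ->
    open_braid_cone I (C `&` Q) V ->
    (N (C `&` P) < n)%N.
  move=> PQ CQ; rewrite ltnS in leN; apply: leq_trans leN.
  have [t [Ct Qt]] := obc_cell_mem I0 CQ.
  apply/proper_card/fintype.properP; split.
    by apply/fintype.subsetP => u; rewrite !inE => -[].
  exists t; first by rewrite !inE.
  rewrite inE; apply/asboolP => -[_ Pt]; have : (P `&` Q) (cell t) by [].
  by rewrite PQ.
have dW : \dim W = (\dim (W :&: lker (coord_diff R a b))).+1.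
  have [y Cy yl] := nle; apply: (@dimv_cap_lker1 _ _ _ _ y); first exact: (obc_span CW).
  by rewrite coord_diffE subr_eq0 lt_eqF.
have -> : \sum_(s | `[< C (cell s) >]) (-1) ^+ size (blocks s) =
    chi (C `&` [set y | y a < y b]) + chi (C `&` [set y | y b < y a]) +
    chi (C `&` [set y | y a = y b]).
  rewrite /chi big_mkcond [X in _ = X + _ + _]big_mkcond.
  rewrite [X in _ = _ + X + _]big_mkcond [X in _ = _ + X]big_mkcond -!big_split.
  apply: eq_bigr => t _ /=.
  have ltE u v : `[< (C `&` [set y | y u < y v]) (cell t) >] =
      `[< C (cell t) >] && (cell t u < cell t v).
    apply/asboolP/andP => [[? ?]|[/asboolP ? ?]] //; split=> //; exact/asboolP.
  have eqE : `[< (C `&` [set y | y a = y b]) (cell t) >] =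
      `[< C (cell t) >] && (cell t a == cell t b).
    apply/asboolP/andP => [[? ?]|[/asboolP ? /eqP ?]] //; split=> //;
      [exact/asboolP|exact/eqP].
  rewrite !ltE eqE; case: `[< _ >]; rewrite ?addr0 //=.
  by case: ltgtP; rewrite ?addr0 ?add0r.
rewrite /chi (IH _ _ _ Hlt) ?(IH _ _ _ Hgt) ?(IH _ _ _ Heq).
- by rewrite dW exprS mulN1r subrK.
- by apply: (smaller _ _ _ _ Hlt); apply/seteqP; split=> // y [/= ->]; rewrite ltxx.
- by apply: (smaller _ _ _ _ Hlt); apply/seteqP; split=> // y /= []; lra.
- by apply: (smaller _ _ _ _ Hgt); apply/seteqP; split=> // y /= []; lra.
Qed.
End Euler.

(** * The iterated coproduct computes faces *)

Section Faces.
Variables (R : realType) (T : finType).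
Implicit Types (I S U : {set T}) (y z w : vec R T).

Lemma gp_face_same_cell I (p : set (vec R T)) y z : is_gp I p ->
  coord_space I y -> coord_space I z -> same_cell I y z -> face p y = face p z.
Proof.
move=> /gpP[_ _ _ h] cy cz yz.
by apply/seteqP; split; apply: h => //; split=> // i j iI jI; rewrite yz.
Qed.

(** Taking the faces maximal on x and then on z is taking the face maximal on
    any y that refines x and orders the level sets of x as z does: the iterated
    face is maximal on x + e y for small e, and x + e y is in the cell of y. *)
Lemma gp_face_iter I (p : set (vec R T)) x y z : is_gp I p ->
  coord_space I x -> coord_space I y -> coord_space I z ->
  {in I &, forall i j, y i <= y j -> x i <= x j} ->
  {in I &, forall i j, x i = x j -> (y i <= y j) = (z i <= z j)} ->
  face (face p x) z = face p y.
Proof.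
move=> gp cx cy cz yx yz.
have -> : face (face p x) z = face (face p x) y.
  apply/seteqP; split; apply: (gp_face_sub gp) => //.
    by move=> i j iI jI /(yz _ _ iI jI) ->.
  by move=> i j iI jI /(yz _ _ iI jI) ->.
have [_ pp p0 _] := gp.
have [e e0 he] := face_perturb x y pp p0.
rewrite -(he e); last by rewrite e0 lexx.
apply: (gp_face_same_cell gp) => //; first exact/coordD/coordZ.
move=> i j iI jI; rewrite !ffunE /GRing.scale /=.
have [le|lt] := leP (y i) (y j).
  by rewrite lerD // ?ler_pM2l // yx.
by apply/negbTE; rewrite -ltNge ler_ltD ?ltr_pM2l // yx // ltW.
Qed.

Lemma face_prod_set S U (p q : set (vec R T)) y :
  disjoint_sets S U -> p !=set0 -> p `<=` coord_space S -> coord_space U y ->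
  face (prod_set p q) y = prod_set p (face q y).
Proof.
move=> dSU [x0 px0] pS yU.
have dot0 x : p x -> dot y x = 0.
  move=> /pS cx; rewrite -(dot_restr _ cx) (@restr_disj _ _ S U) //.
  by rewrite dotC dot0r.
apply/seteqP; split=> [_ [[x px [x' qx' <-]] m]|_ [x px [x' [qx' m] <-]]].
  exists x => //; exists x' => //; split=> // w qw.
  have := m (x + w); rewrite !dotDr (dot0 _ px) !add0r; apply.
  by exists x => //; exists w.
split; first by exists x => //; exists x'.
by move=> _ [w pw [w' qw' <-]]; rewrite !dotDr (dot0 w pw) (dot0 x px) !add0r; exact: m.
Qed.

(** One coproduct takes the face maximal on 1_(S_1), which is a product; the
    remaining ones take a face of its second factor only. *)
Lemma face_iter_coprod S Ss (p : gp R (blocks_union S Ss)) :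
  composition (blocks_union S Ss) (S :: Ss) ->
  gp_set (iter_prod (iter_coprod p)) = face p (level_vec R (S :: Ss)).
Proof.
elim: Ss S p => [|S' Ss IH] S p cB.
  have [cp _ _ _] := gp_valid p.
  have <- : face p 0 = face p (level_vec R [:: S]).
    apply: (gp_face_same_cell (gp_valid p)).
    - by move=> i _; rewrite ffunE.
    - exact: level_vec_coord cB.
    - by move=> i j /= iS jS; rewrite !ffunE /= iS jS !lexx.
  by apply/seteqP; split=> [x px|x []//]; split=> // x' _;
    rewrite ![dot 0 _]dotC !dot0r.
set U := blocks_union S' Ss in p cB IH *.
have dSU : disjoint_sets S U.
  have := cB; rewrite -set_composition_rec => /and3P[_ /andP[+ _] _].
  by rewrite -disjoint_blocks_union.
have cU : composition U (S' :: Ss).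
  move: cB => /and3P[_ _]; rewrite finset.setDUl finset.setDv finset.set0U.
  by rewrite (finset.setDidPl _) // disjoint_sym.
have cS : coord_space (S :|: U)%SET (indicator R S).
  by apply: indicator_coord; exact: finset.subsetUl.
have cl : coord_space (S :|: U)%SET (level_vec R (S' :: Ss)).
  by apply: coordS (level_vec_coord _ cU); exact: finset.subsetUr.
rewrite [LHS]/= IH // -(@face_prod_set S U) -?gp_coprodP //;
  last exact: level_vec_coord.
  apply: (gp_face_iter (gp_valid p)) => //; first exact: level_vec_coord cB.
    move=> i j _ _; rewrite level_vec_le !ffunE ler_nat [level (_ :: _ :: _) i]/=.
    case: ifP => // iS; rewrite [level _ j]/=; case: (j \in S) => //.
    by rewrite ltnNge (level_le_size (S' :: Ss)).
  move=> i j _ _; rewrite !level_vec_le !ffunE.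
  have notU l : l \in S -> level (S' :: Ss) l = 0%N.
    by move=> lS; apply/eqP; rewrite -leqn0 leqNgt (level_gt0 _ cU) (disjointFr dSU).
  rewrite [level (S :: _) i]/= [level (S :: _) j]/=.
  rewrite -/(level (S' :: Ss) i) -/(level (S' :: Ss) j).
  have [iS|iS] := ifPn; have [jS|jS] := ifPn => // /eqP.
  - by rewrite leqnn !notU.
  - by rewrite oner_eq0.
  - by rewrite eq_sym oner_eq0.
- by have [] := gp_valid (gp_coprod p).1.
- by have [] := gp_valid (gp_coprod p).1.
Qed.

Definition gp_face I (p : gp R I) y (yI : coord_space I y) : gp R I :=
  GP (is_gp_face (gp_valid p) yI).

Lemma mu_Delta_basis (k : fieldType) I n (s : compositions I n) (p q : gp R I) :
  gp_set q = face p (level_vec R ((val s).1 :: (val s).2)) ->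
  mu_Delta s (basis_elt k p) = basis_elt k q.
Proof.
have : composition I ((val s).1 :: (val s).2).
  by case: s => s h; rewrite -set_composition_rec.
rewrite /mu_Delta; move: (compositions_union s) p q.
move: (val s).1 (tval (val s).2) => S Ss e; case: _ / e => p q cB E.
rewrite /mu /Delta /linear_ext /basis_elt liftU scale1r liftU scale1r.
by congr [freeg [:: (_, _)]]; apply: gp_inj; rewrite face_iter_coprod.
Qed.

End Faces.

(** * The cone of directions in which a given face is maximal *)

Section FaceCone.
Variables (R : realType) (T : finType) (I : {set T}).

Lemma direction_coord (q : gp R I) (U : {vspace vec R T}) :
  (forall w, w \in U <-> coord_space I w) -> (direction q <= U)%VS.
Proof.
move=> UE; have [qI _ _ _] := gp_valid q.
apply: (directionP q).2 => x y /qI xI /qI yI.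
by apply: rpredB; apply/UE.
Qed.

Lemma orthogonal_direction (q : set (vec R T)) w :
  (forall x, x \in direction q -> dot w x = 0) <->
  (forall x y, q x -> q y -> dot w x = dot w y).
Proof.
have [dq least] := directionP q; split=> [w0 x y qx qy|wc x].
  by apply/eqP; rewrite -subr_eq0 -mulN1r -dotZr -dotDr scaleN1r w0 // dq.
have [V [_ VE _]] := orthogonal_complement (subvf <[w]>%VS).
have /subvP sV : (direction q <= V)%VS.
  apply: least => u v qu qv; rewrite VE memvf; apply/asboolP => _ /vlineP[a ->].
  by rewrite dotZr dotC dotDr -scaleN1r dotZr mulN1r (wc u v) // subrr mulr0.
by move=> /sV; rewrite VE => /andP[_ /asboolP/(_ w (memv_line w))]; rewrite dotC.
Qed.

(** The set is the relative interior of the normal cone of p at q.  For w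
    orthogonal to the directions of q, the face of p maximal on y + t w is the
    face of q maximal on w, which is q; so W is the orthogonal complement of
    these directions in R^I. *)
Lemma face_open_braid_cone (p q : gp R I) : faces p q ->
  exists W, open_braid_cone I [set y | coord_space I y /\ face p y = q] W /\
    (\dim W + polytope_dim q = #|I|)%N.
Proof.
move=> [y0 cy0 qy0].
have [_ pp p0 _] := gp_valid p; have [_ _ [x0 qx0] _] := gp_valid q.
have [U [dU UE]] := coord_vspace R I.
have [W [WU WE dW]] := orthogonal_complement (direction_coord q UE).
have inW w : w \in W <-> coord_space I w /\
    forall x y, gp_set q x -> gp_set q y -> dot w x = dot w y.
  rewrite WE -orthogonal_direction; split.
    by move=> /andP[/UE ? /asboolP].
  by move=> [/UE -> wd]; apply/asboolP.
exists W; split; last by rewrite dW dU.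
split.
- by exists y0.
- move=> y [cy qy]; apply/inW; split=> // x x'; rewrite -qy => -[px mx] [px' mx'].
  by apply/eqP; rewrite eq_le mx // mx'.
- by move=> w /inW[].
- move=> y z a b [cy qy] [cz qz] a0 b0; split; first by apply: coordD; exact: coordZ.
  (* a point of p maximal on a y + b z must be maximal on both y and z, as x0
     is *)
  have := qx0; rewrite -[X in X x0]qy => -[px0 my].
  have := qx0; rewrite -[X in X x0]qz => -[_ mz].
  rewrite -qy; apply/seteqP; split=> x [px m]; split=> // x' px'.
    apply: le_trans (my _ px') _.
    have := m _ px0; rewrite !dotDl !dotZl => le.
    have lz : b * dot z x <= b * dot z x0 by rewrite ler_pM2l // mz.
    have : a * dot y x0 <= a * dot y x by lra.
    by rewrite ler_pM2l.
  rewrite !dotDl !dotZl lerD // ler_pM2l //; first exact: m.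
  have : gp_set q x by rewrite -qy.
  by rewrite -[X in X x]qz => -[_]; apply.
- move=> y w [cy qy] /inW[cw wq].
  have [e e0 he] := face_perturb y w pp p0; exists e => // t te; split.
    exact/coordD/coordZ.
  rewrite he // qy; apply/seteqP; split=> [x []//|x qx]; split=> // x' qx'.
  by rewrite (wq x x').
- move=> y z [cy qy] cz yz; split=> //.
  by rewrite -(gp_face_same_cell (gp_valid p) cy).
Qed.

(** * The antipode *)

Definition cell_face (p : gp R I) (s : comps I) : gp R I :=
  gp_face p (cell_coord R s).

Lemma faces_cell_face (p : gp R I) s : faces p (cell_face p s).
Proof. by exists (cell R s) => //; exact: cell_coord. Qed.

Lemma finite_faces (p : gp R I) : I != finset.set0 -> finite_set (faces p).
Proof.
move=> I0; apply: (@sub_finite_set _ _ (range (cell_face p))); last first.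
  exact/finite_image/finite_finset.
move=> q [y cy qy]; have [s ys] := cell_exists y I0; exists s => //.
apply: gp_inj; rewrite /= qy; apply/esym.
exact: (gp_face_same_cell (gp_valid p) cy (cell_coord R s)).
Qed.

Lemma antipode_cells (k : fieldType) (p : gp R I) : I != finset.set0 ->
  antipode (basis_elt k p) =
    \sum_(s : comps I) (-1) ^+ size (blocks s) *: basis_elt k (cell_face p s).
Proof.
move=> I0; rewrite /antipode (negbTE I0).
rewrite (sig_big_dep _ (fun=> xpredT)
  (fun (n : 'I_#|I|) (s : compositions I n) =>
     (-1) ^+ n.+1 *: mu_Delta s (basis_elt k p))) /=.
apply: eq_bigr => -[n s] _ /=; rewrite size_tuple; congr (_ *: _).
exact: mu_Delta_basis.
Qed.

Lemma coeff_antipode (k : fieldType) (p q : gp R I) :  I != finset.set0 ->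
  faces p q -> coeff q (antipode (basis_elt k p)) =
    (-1) ^+ #|I| * (-1) ^+ polytope_dim q.
Proof.
move=> I0 qp; have [W [CW dW]] := face_open_braid_cone qp.
have -> : (-1) ^+ #|I| * (-1) ^+ polytope_dim q = (-1) ^+ \dim W :> k.
  by rewrite -dW exprD -mulrA -exprD addnn -mul2n exprM sqrrN !expr1n mulr1.
rewrite antipode_cells // raddf_sum -(obc_euler k I0 CW) [RHS]big_mkcond.
apply: eq_bigr => s _ /=; rewrite coeffZ coeffU mul1r.
have -> : `[< coord_space I (cell R s) /\ face p (cell R s) = q >] =
    (cell_face p s == q).
  apply/asboolP/eqP => [[_ E]|<-]; first exact: gp_inj.
  by split=> //; exact: cell_coord.
by case: eqP => _; rewrite ?mulr1 ?mulr0.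
Qed.

End FaceCone.

(** The case in which there are no compositions: the antipode is the identity on
    the single point of R^0. *)
Lemma faces_set0 (R : realType) (T : finType) (p : gp R (finset.set0 : {set T})) :
  faces p = [set p] /\ polytope_dim p = 0%N.
Proof.
have only0 (y : vec R T) : coord_space finset.set0 y -> y = 0.
  by move=> cy; apply/ffunP => i; rewrite cy ?inE // ffunE.
split.
  have p_face y : coord_space finset.set0 y -> face p y = p.
    move=> /only0 ->; apply/seteqP; split=> [x []//|x px]; split=> // x' _.
    by rewrite ![dot 0 _]dotC !dot0r.
  apply/seteqP; split=> q /=.
    by move=> [y /p_face ->] E; apply: gp_inj.
  by move=> ->; exists 0;
    [move=> i _; rewrite ffunE|rewrite p_face // => i _; rewrite ffunE].
apply/eqP; rewrite dimv_eq0 -subv0; apply: (directionP p).2 => x y.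
have [pI _ _ _] := gp_valid p.
by move=> /pI/only0 -> /pI/only0 ->; rewrite subrr memv0.
Qed.

Theorem theorem1p1 (R : realType) (k : fieldType) (T : finType) (I : {set T})
    (p : gp R I) :
  [pchar k] =i pred0 ->
  [/\ finite_set (faces p),
      antipode (basis_elt k p) =
        (-1) ^+ #|I| *:
          \sum_(q \in faces p) (-1) ^+ polytope_dim q *: basis_elt k q,
      cancellation_free (faces p)
        (fun q => (-1) ^+ #|I| * (-1) ^+ polytope_dim q) id &
      grouping_free (faces p) id].
Proof.
move=> _; have [I0|I0] := eqVneq I finset.set0.
  subst I; have [-> dp] := faces_set0 p; split.
  - exact: finite_set1.
  - by rewrite fsbig_set1 dp cards0 !scale1r /antipode eqxx.
  - by move=> a b _ _ ab [].
  - by move=> a b _ _ ab.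
have fin := finite_faces p I0; split=> //.
  apply/eqP/freeg_eqP => q; rewrite coeffZ fsbig_finite // raddf_sum /=.
  have summand (r : gp R I) : coeff q ((-1) ^+ polytope_dim r *: basis_elt k r) =
      (-1) ^+ polytope_dim r * (r == q)%:R by rewrite coeffZ coeffU mul1r.
  have [qp|nqp] := pselect (faces p q).
    rewrite coeff_antipode // (bigD1_seq q) ?fset_uniq //=; last first.
      by rewrite in_fset_set // inE.
    rewrite summand eqxx mulr1 big1 ?addr0 // => r rq.
    by rewrite summand (negbTE rq) mulr0.
  rewrite antipode_cells // raddf_sum /= big1 => [|s _]; last first.
    rewrite coeffZ coeffU; case: eqP => [E|_]; last by rewrite !mulr0.
    by case: nqp; rewrite -E; exact: faces_cell_face.
  rewrite big_seq big1 ?mulr0 // => r; rewrite in_fset_set // inE summand => rp.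
  by case: eqP => [E|_]; rewrite ?mulr0 //; case: nqp; rewrite -E.
- by move=> a b _ _ ab [].
Qed.
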